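(* The following are equivalent: (a) every analytic productively Lindelöf space is $\sigma$-compact; (b) there is a Michael space.
   Context: A space is analytic (in the sense of Arhangel'skiĭ) if it is a continuous image of the space $\mathbb{P}$ of irrational numbers. A topological space is productively Lindelöf if its product with every Lindelöf space is Lindelöf. A Michael space is a Lindelöf space $M$ such that $M\times\mathbb{P}$ is not Lindelöf.
   Formalization: All spaces (the analytic spaces, the Lindelöf test spaces in ''productively Lindelöf'', and the Michael space) are taken to be Tychonoff; without separation axioms a Hausdorff non-regular analytic productively Lindelöf space that is not σ-compact exists, so the equivalence fails under CH. *)

(* Defs.v *)
From HB Require Import structures.
From mathcomp Require Import all_boot all_order all_algebra.
From mathcomp Require Import all_classical all_reals all_analysis.
From mathcomp Require Import Rstruct Rstruct_topology.
From Stdlib Require Import Rdefinitions.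

Set Implicit Arguments.
Unset Strict Implicit.
Unset Printing Implicit Defensive.

Import Order.TTheory GRing.Theory Num.Theory.
Local Open Scope classical_set_scope.
Local Open Scope ring_scope.

Definition irrationals : set R := ~` range (@ratr R).

(* The space P of irrational numbers, with the subspace topology
   (the sigma type [set_type irrationals] with the initial topology
   of the inclusion into R). *)
Definition Irr : topologicalType := set_type irrationals.

(* Standing convention: "space" = Tychonoff space
   (completely regular Hausdorff). *)
Definition tychonoff_space (X : topologicalType) : Prop :=
  completely_regular_space X /\ hausdorff_space X.

Definition lindelof (X : topologicalType) : Prop :=
  forall C : set (set X),
    (forall U, C U -> open U) -> \bigcup_(U in C) U = setT ->
    exists2 D : set (set X),
      D `<=` C /\ countable D & \bigcup_(U in D) U = setT.

Definition sigma_compact_space (X : topologicalType) : Prop :=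
  exists K : nat -> set X,
    (forall n, compact (K n)) /\ \bigcup_n K n = setT.

Definition analytic (X : topologicalType) : Prop :=
  exists f : Irr -> X, continuous f /\ (forall y : X, exists x : Irr, f x = y).

Definition productively_lindelof (X : topologicalType) : Prop :=
  forall Y : topologicalType, tychonoff_space Y -> lindelof Y ->
    lindelof (X * Y)%type.

Definition michael_space (M : topologicalType) : Prop :=
  lindelof M /\ ~ lindelof (M * Irr)%type.

(* Main.v *)
Require Import Defs.
From mathcomp Require Import all_boot all_order all_algebra.
From mathcomp Require Import all_classical all_reals all_analysis.
From mathcomp Require Import Rstruct Rstruct_topology.

(** (a) implies (b): the space of irrationals is analytic and, by Baire, not sigma-compact,
    so by (a) some Lindelöf space has a non-Lindelöf product with it.

    (b) implies (a): let [X] be the image of the irrationals under a continuous [f] and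
    suppose that [X] is not sigma-compact.  The irrationals carry a complete scheme of cells
    indexed by finite sequences.  Call a cell heavy if its image is not covered by countably
    many compact sets.  After removing the points lying in some light cell, the image of a
    heavy cell has a non-compact closure, so, [X] being regular and Lindelöf, there is an
    increasing open cover of [X] each member of which is avoided by the image of some smaller
    heavy cell.  Iterating gives a tree of increasing open covers [W s] of [X] such that
    for every branch [g] some point of [X] lies in no [W (g|n) (g n)].  Sending [x] to the
    set of branches [g] with [x] outside all [W (g|n) (g n)] is therefore an upper
    semicontinuous compact-valued map from [X] onto the Baire space.  Hence if [X * M] is
    Lindelöf then so is the product of [M] with the irrationals, and [M] is not a
    Michael space. *)

Set Implicit Arguments.
Unset Strict Implicit.
Unset Printing Implicit Defensive.

Import Order.TTheory GRing.Theory Num.Theory.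
Local Open Scope classical_set_scope.
Local Open Scope ring_scope.

Local Notation R := Rdefinitions.R.

(** * The irrationals as a subspace of the line *)

Lemma val_Irr_continuous : continuous (set_val : Irr -> R).
Proof. exact: initial_continuous. Qed.

Lemma nbhs_IrrP (y : Irr) (A : set Irr) :
  nbhs y A -> exists2 e : R, 0 < e & forall z : Irr, `|val y - val z| < e -> A z.
Proof.
case=> _ [[W oW <-] /= Wy WA].
move: oW; rewrite openE => /(_ _ Wy) /nbhs_ballP[e /= e0 eW].
by exists e => // z yz; apply: WA; apply: eW.
Qed.

Lemma Irr_tychonoff : tychonoff_space Irr.
Proof.
split.
  exact: (@uniform_completely_regular Rdefinitions.R (set_type irrationals)).
move=> x y xy; apply: val_inj.
apply: (@Rhausdorff R) => A B Ax By.
have [z [Az Bz]] := xy _ _ (val_Irr_continuous Ax) (val_Irr_continuous By).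
by exists (val z).
Qed.

Lemma Irr_analytic : analytic Irr.
Proof. by exists id; split=> [x|y]; [exact: cvg_id|exists y]. Qed.

Lemma Irr_irrational (y : Irr) (q : rat) : ratr q != val y.
Proof.
case: y => x /= /set_mem ix; apply/eqP => qx; apply: ix.
by exists q.
Qed.

(** Two distinct rationals lie just to the right of [x], so one of them differs from [p]. This
    provides the density in the Baire argument below. *)
Lemma open_rat_neq (O : set R) (p : rat) : O !=set0 -> open O ->
  exists2 q : rat, q != p & O (ratr q).
Proof.
move=> [x Ox]; rewrite openE => /(_ _ Ox) /nbhs_ballP[e /= e0 eO].
have xe : x < x + e by rewrite ltrDl.
have [q /itvP qx] := rat_in_itvoo xe.
have xq : x < ratr q by rewrite qx.
have [r /itvP rx] := rat_in_itvoo xq.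
have inO s : x < ratr s < x + e -> O (ratr s).
  move=> /andP[xs sx]; apply: eO; rewrite /ball /= distrC ger0_norm ?subr_ge0 ?ltW//.
  by rewrite ltrBlDl.
have rq : r != q by rewrite -(inj_eq (@fmorph_inj _ _ (@ratr R))) lt_eqF// rx.
have [qp|qp] := eqVneq q p.
  by exists r; [rewrite -qp|apply: inO; rewrite rx (lt_trans _ (_ : ratr q < _)) ?rx ?qx].
by exists q => //; apply: inO; rewrite !qx.
Qed.

Lemma Irr_not_sigma_compact : ~ sigma_compact_space Irr.
Proof.
move=> [K [cK KT]].
pose A n : set R := set_val @` K n.
have cA n : closed (A n).
  apply: compact_closed; first exact: Rhausdorff.
  apply: continuous_compact => //.
  exact/continuous_subspaceT/val_Irr_continuous.
(* Since [A n] holds only irrationals, rationals witness the density of [F n]. Deleting the rational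
   with code [n] leaves only irrationals in the intersection. *)
pose F n : set R := ~` A n `&` ~` [set ratr q | q in [set q | pickle q = n]].
have oF n : open (F n) /\ dense (F n).
  split.
    apply: openI; first exact: closed_openC.
    apply: closed_openC.
    (* At most one rational has code [n], so the deleted set is a singleton or empty. *)
    have -> : [set ratr q | q in [set q : rat | pickle q = n]] =
        if @unpickle rat n is Some q then [set x : R | pickle q = n /\ x = ratr q] else set0.
      apply/seteqP; split=> [_ [q <- <-]|x].
        by rewrite pickleK.
      by case: unpickle => [q [<- ->]|//]; exists q.
    case: unpickle => [q|]; last exact: closed0.
    have [->|ne] := eqVneq (pickle q) n.
      by rewrite (_ : [set x | _] = [set ratr q :> R]);
        [exact/accessible_closed_set1/hausdorff_accessible/Rhausdorff|apply/seteqP; split=> [x []|x]].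
    rewrite (_ : [set x | _] = set0); first exact: closed0.
    by apply/seteqP; split=> [x [/eqP]|//]; rewrite (negPf ne).
  move=> O O0 oO.
  have [p pn] : exists p : rat, forall q : rat, pickle q = n -> q = p.
    have [[p pn]|h] := pselect (exists p : rat, pickle p = n).
      by exists p => q; rewrite -pn => /(pcan_inj pickleK).
    by exists 0 => q qn; case: h; exists q.
  have [q qp Oq] := open_rat_neq p O0 oO.
  exists (ratr q); split=> //; split.
    by move=> [y _ /esym/eqP]; apply/negP/Irr_irrational.
  by move=> [r /pn -> /(@fmorph_inj _ _ (@ratr R)) /esym/eqP]; apply/negP.
have [x [_ Fx]] := @Baire R R^o F oF setT (ex_intro setT (0 : R) I) openT.
have ix : irrationals x.
  by move=> [q _ qx]; have [_] := Fx (pickle q) I; apply; exists q.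
have [n _ Kx] : (\bigcup_n K n) (SigSub (mem_set ix)) by rewrite KT.
by have [+ _] := Fx n I; apply; exists (SigSub (mem_set ix)).
Qed.

(** * A complete scheme of closed cells *)

(* At stage i, a piece has diameter at most 2/(i+1) and stays away from the i-th rational. *)
Definition piece (i k : nat) : set R :=
  if unpickle k is Some (c, N) then
    [set x | `|x - ratr c| <= i.+1%:R^-1] `&`
    [set x | forall q : rat, pickle q = i -> N.+1%:R^-1 <= `|x - ratr q|]
  else set0.

(* Sequences are stored in reverse: the head is the last choice made. *)
Fixpoint cell (s : seq nat) : set R :=
  if s is k :: s' then cell s' `&` piece (size s') k else setT.

Lemma cell_cat (u s : seq nat) : cell (u ++ s) `<=` cell s.
Proof. by elim: u => [|k u IH] //= x [/IH]. Qed.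

Lemma dist_continuous (c : R) : continuous (fun x : R => `|x - c|).
Proof.
move=> x; apply: (@cvg_norm _ R^o); apply: (@cvgB _ R^o); [exact: cvg_id|exact: cvg_cst].
Qed.

Lemma closed_dist_le (c e : R) : closed [set x : R | `|x - c| <= e].
Proof.
apply: (@preimage_closed _ _ (fun x : R => `|x - c|) [set z | z <= e]).
  by move=> x _; exact: dist_continuous.
exact: closed_le.
Qed.

Lemma closed_dist_ge (c e : R) : closed [set x : R | e <= `|x - c|].
Proof.
apply: (@preimage_closed _ _ (fun x : R => `|x - c|) [set z | e <= z]).
  by move=> x _; exact: dist_continuous.
exact: closed_ge.
Qed.

Lemma closed_cell s : closed (cell s).
Proof.
elim: s => [|k s IH] /=; first exact: closedT.
apply: closedI => //; rewrite /piece; case: unpickle => [[c N]|]; last exact: closed0.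
apply: closedI; first exact: closed_dist_le.
rewrite (_ : [set x | _] = \bigcap_(q in [set q : rat | pickle q = size s])
   [set x : R | N.+1%:R^-1 <= `|x - ratr q|]) //.
by apply: closed_bigI => q _; exact: closed_dist_ge.
Qed.

Lemma cell_small (s : seq nat) (i : nat) : (i < size s)%N ->
  exists c : R, forall x, cell s x -> `|x - c| <= i.+1%:R^-1.
Proof.
elim: s => [//|k s IH] /=; rewrite ltnS leq_eqVlt => /orP[/eqP ->|/IH[c cP]].
  rewrite /piece; case: unpickle => [[c N]|]; last by exists 0 => x [].
  by exists (ratr c) => x [_ []].
by exists c => x [/cP].
Qed.

Lemma cell_irrational (s : seq nat) (q : rat) x : (pickle q < size s)%N -> cell s x -> x != ratr q.
Proof.
elim: s => [//|k s IH] /=; rewrite ltnS leq_eqVlt => /orP[/eqP qs|/IH + [xs _]]; last exact.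
move=> [_]; rewrite /piece; case: unpickle => [[c N]|//] [_ /(_ q qs)].
by apply: contraTneq => ->; rewrite subrr normr0 -ltNge invr_gt0.
Qed.

Lemma piece_cover (x : R) i : (forall q : rat, x != ratr q) -> exists k, piece i k x.
Proof.
move=> xq.
have [c cx] : exists c : rat, `|x - ratr c| <= i.+1%:R^-1.
  have xe : x < x + i.+1%:R^-1 by rewrite ltrDl invr_gt0.
  have [c /itvP cx] := rat_in_itvoo xe; exists c.
  by rewrite distrC ger0_norm ?subr_ge0 ?cx// lerBlDl cx.
have [N NP] : exists N : nat, forall q : rat, pickle q = i -> N.+1%:R^-1 <= `|x - ratr q|.
  have [[q qi]|h] := pselect (exists q : rat, pickle q = i); last first.
    by exists 0%N => q qi; case: h; exists q.
  have d0 : 0 < `|x - ratr q| by rewrite normr_gt0 subr_eq0.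
  have [N _ NP] := near_infty_natSinv_lt (PosNum d0).
  exists N => r; rewrite -qi => /(pcan_inj pickleK) ->.
  by apply/ltW/(NP N); rewrite /=.
by exists (pickle (c, N)); rewrite /piece pickleK.
Qed.

Definition Icell (s : seq nat) : set Irr := [set y | cell s (val y)].

Lemma Icell_cons s y : Icell s y -> exists k, Icell (k :: s) y.
Proof.
move=> sy; have [|k ky] := @piece_cover (val y) (size s); last by exists k.
by move=> q; rewrite eq_sym Irr_irrational.
Qed.

(** Cell diameters are bounded in terms of depth alone, so one [N] serves every cell around [y]. *)
Lemma Icell_nbhs y A : nbhs y A ->
  exists N, forall s, (N <= size s)%N -> Icell s y -> Icell s `<=` A.
Proof.
move=> /nbhs_IrrP[e e0 eA].
have e20 : 0 < e / 2 by rewrite divr_gt0.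
have [N _ NP] := near_infty_natSinv_lt (PosNum e20).
exists N.+1 => s Ns ys z zs; apply: eA.
have [c cP] := cell_small Ns.
rewrite [e]splitr (le_lt_trans (ler_distD c _ _))//.
have Ne : N.+1%:R^-1 < e / 2 by apply: (NP N) => /=.
by rewrite ltrD// (le_lt_trans _ Ne)// ?[`|c - _|]distrC; apply: cP.
Qed.

(** Points chosen in the nested cells form a Cauchy sequence. Its limit stays in the closed cells,
    and is irrational because deep cells keep a positive distance from each given rational. *)
Lemma Icell_complete (s : nat -> seq nat) :
  (forall n, exists2 u, u != [::] & s n.+1 = u ++ s n) ->
  (forall n, Icell (s n) !=set0) -> exists y, forall n, Icell (s n) y.
Proof.
move=> sS /choice[y ys].
have s_le n m : (n <= m)%N -> cell (s m) `<=` cell (s n).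
  move=> /subnK <-; elim: (m - n)%N => [//|d IH] x.
  rewrite addSn; have [u _ ->] := sS (d + n)%N; move=> /cell_cat; exact: IH.
have s_size n : (n <= size (s n))%N.
  elim: n => [//|n IH]; have [[//|k u] _ ->] := sS n.
  by rewrite /= ltnS size_cat (leq_trans IH)// leq_addl.
have : cvg ((fun n => val (y n) : R) @ \oo).
  apply: (@cauchy_cvg R^o); apply: (@cauchy_exP R R^o) => e e0.
  have [N _ NP] := near_infty_natSinv_lt (PosNum e0).
  have [c cP] := cell_small (s_size N.+1).
  exists c; exists N.+1 => // n /= Nn; rewrite /ball /= distrC.
  by rewrite (le_lt_trans _ (NP N _))//=; apply/cP/(s_le _ _ Nn)/ys.
move=> /cvg_ex[l yl].
have ls n : cell (s n) l.
  apply: (closed_cvg (cell (s n)) (@closed_cell (s n)) _ l yl).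
  by exists n => // m /= nm; apply: (s_le _ _ nm); exact: ys.
have il : irrationals l.
  move=> [q _ ql]; have := cell_irrational (s_size (pickle q).+1) (ls _).
  by rewrite ql eqxx.
by exists (SigSub (mem_set il)) => n; exact: ls.
Qed.

(** * Countable covers, by open sets and by compact sets *)

Lemma lindelof_sequence (X : topologicalType) (P : set X -> Prop) :
  lindelof X -> P set0 ->
  (forall x, exists U, [/\ open U, U x & P U]) ->
  exists O : nat -> set X,
    (forall n, open (O n) /\ P (O n)) /\ (forall x, exists n, O n x).
Proof.
move=> lX P0 PX.
have [||D [DP /countable_injP[f fD]] DT] := lX [set U | open U /\ P U].
- by move=> U [].
- by apply/seteqP; split=> // x _; have [U [oU Ux PU]] := PX x; exists U.
(* The subcover may be finite: indices not in use receive the empty set. *)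
have : forall n, exists U, [/\ open U, P U & forall V, D V -> f V = n -> U = V].
  move=> n; have [[V DV Vn]|h] := pselect (exists2 V, D V & f V = n).
    exists V; have [oV PV] := DP _ DV; split=> // V' DV' V'n.
    by apply: fD; rewrite ?inE// Vn.
  by exists set0; split=> [|//|V DV Vn]; [exact: open0|case: h; exists V].
move=> /choice[Q QP]; exists Q; split=> [n|x]; first by have [] := QP n.
have [V DV Vx] : (\bigcup_(U in D) U) x by rewrite DT.
by exists (f V); have [_ _ /(_ V DV erefl)->] := QP (f V).
Qed.

Definition sigma_covered (X : topologicalType) (A : set X) : Prop :=
  exists K : nat -> set X, (forall n, compact (K n)) /\ A `<=` \bigcup_n K n.

Lemma sigma_covered_sub (X : topologicalType) (A B : set X) :
  A `<=` B -> sigma_covered B -> sigma_covered A.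
Proof. by move=> AB [K [cK BK]]; exists K; split=> // x /AB/BK. Qed.

Lemma sigma_covered_compact (X : topologicalType) (A : set X) :
  compact A -> sigma_covered A.
Proof. by move=> cA; exists (fun=> A); split=> // x Ax; exists 0%N. Qed.

Lemma sigma_covered_bigcup (X : topologicalType) (I : countType) (A : I -> set X) :
  (forall i, sigma_covered (A i)) -> sigma_covered (\bigcup_i A i).
Proof.
move=> /choice[K KP].
exists (fun m => if @unpickle (I * nat)%type m is Some (i, n) then K i n else set0).
split=> [m|x [i _ /(proj2 (KP i))[n _ Kx]]].
  by case: unpickle => [[i n]|]; [exact: (proj1 (KP i))|exact: compact0].
by exists (pickle (i, n)) => //; rewrite pickleK.
Qed.

Lemma sigma_coveredU (X : topologicalType) (A B : set X) :
  sigma_covered A -> sigma_covered B -> sigma_covered (A `|` B).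
Proof.
move=> sA sB.
apply: (@sigma_covered_sub _ _ (\bigcup_(b : bool) if b then A else B)).
  by move=> x [Ax|Bx]; [exists true|exists false].
by apply: sigma_covered_bigcup => -[].
Qed.

(** Non-compactness gives a filter [F] containing the closure, without cluster point there. Each
    point then has an open neighbourhood whose closure has its complement in [F]; finite unions of
    countably many of these form the cover. *)
Lemma noncompact_closure_covers (X : topologicalType) (A : set X) :
  regular_space X -> lindelof X -> ~ compact (closure A) ->
  exists U : nat -> set X,
    [/\ forall k, open (U k), forall k, U k `<=` U k.+1,
        forall x : X, exists k, U k x
      & forall k, exists2 x, A x & nbhs x (~` U k)].
Proof.
move=> rX lX /existsNP[F /not_implyP[FF /not_implyP[FA noc]]].
have sep (x : X) : exists B N, [/\ F B, nbhs x N & N `<=` ~` B].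
  have [xA|xA] := pselect (closure A x); last first.
    exists (closure A), (~` closure A); split=> //.
    by apply: open_nbhs_nbhs; split=> //; exact/closed_openC/closed_closure.
  have : ~ cluster F x by move=> xF; apply: noc; exists x.
  move=> /existsNP[B /existsNP[N /not_implyP[FB /not_implyP[xN BN]]]].
  by exists B, N; split=> // z Nz Bz; apply: BN; exists z.
have [||Q [QP QT]] := @lindelof_sequence X (fun U => F (~` closure U)) lX.
- by rewrite closure0 setC0; exact: filterT.
- move=> x; have [B [N [FB xN NB]]] := sep x.
  have [V xV VN] := rX x N xN.
  exists V°; split; [exact: open_interior|by []|].
  apply: filterS FB => z Bz /(closureS (@interior_subset _ V)) /VN /NB; exact.
exists (fun k => [set x | exists2 i, (i < k)%N & Q i x]); split.
- move=> k; rewrite (_ : [set x | _] = \bigcup_(i in [set i | (i < k)%N]) Q i) //.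
  by apply: bigcup_open => i _; have [] := QP i.
- by move=> k x [i ik Ox]; exists i => //; exact: ltnW.
- by move=> x; have [n On] := QT x; exists n.+1, n.
move=> k.
(* An open member of [F] meets the closure of [A], hence [A] itself, and is a neighbourhood of the
   point found. *)
have [G [oG FG Gk]] : exists G : set X,
    [/\ open G, F G & forall x, G x -> ~ exists2 i, (i < k)%N & Q i x].
  elim: k => [|k [G [oG FG Gk]]].
    by exists setT; split=> [||x _ [] //]; [exact: openT|exact: filterT].
  exists (G `&` ~` closure (Q k)); split.
  - by apply: openI => //; exact/closed_openC/closed_closure.
  - by apply: filterI => //; have [] := QP k.
  move=> x [Gx xO] [i]; rewrite ltnS leq_eqVlt => /orP[/eqP ->|ik] Oi.
    by apply: xO; exact: subset_closure.
  by apply: (Gk x Gx); exists i.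
have [z [zA Gz]] := filter_ex (filterI FA FG).
have [x [Ax Gx]] := zA _ (open_nbhs_nbhs (conj oG Gz)).
by exists x => //; apply: filterS (open_nbhs_nbhs (conj oG Gx)) => w /Gk.
Qed.

(** * Heavy cells and the tree of covers *)

Lemma Icell_extend s y n : Icell s y -> exists2 u, size u = n & Icell (u ++ s) y.
Proof.
move=> sy; elim: n => [|n [u <- uy]]; first by exists [::].
by have [k ky] := Icell_cons uy; exists (k :: u).
Qed.

Lemma heavy_cell_covers (X : topologicalType) (f : Irr -> X) (s : seq nat) :
  regular_space X -> lindelof X -> continuous f ->
  ~ sigma_covered (f @` Icell s) ->
  exists U : nat -> set X,
    [/\ forall k, open (U k), forall k, U k `<=` U k.+1,
        forall x : X, exists k, U k x
      & forall k, exists u, [/\ u != [::], ~ sigma_covered (f @` Icell (u ++ s))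
                              & f @` Icell (u ++ s) `<=` ~` U k]].
Proof.
move=> rX lX cf Ts.
(* [B] keeps the points lying in no light cell that extends [s]. Countably many light cells cover
   the rest, so a compact closure of the image of [B] would make [s] light. *)
pose B := [set y | Icell s y /\
  forall u, Icell (u ++ s) y -> ~ sigma_covered (f @` Icell (u ++ s))].
have nB : ~ compact (closure (f @` B)).
  move=> cB; apply: Ts.
  pose L u := if `[< sigma_covered (f @` Icell (u ++ s)) >]
              then f @` Icell (u ++ s) else set0.
  apply: (@sigma_covered_sub _ _ (closure (f @` B) `|` \bigcup_u L u)).
    move=> _ [y sy <-]; have [By|] := pselect (B y).
      by left; apply: subset_closure; exists y.
    move=> nBy; right.
    have [u uy su] : exists2 u, Icell (u ++ s) y & sigma_covered (f @` Icell (u ++ s)).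
      apply: contrapT => h; apply: nBy; split=> // u uy su; apply: h.
      by exists u.
    by exists u => //; rewrite /L; case: asboolP => // _; exists y.
  apply: sigma_coveredU; first exact: sigma_covered_compact.
  apply: sigma_covered_bigcup => u; rewrite /L; case: asboolP => // _.
  by apply: sigma_covered_compact; exact: compact0.
have [U [oU mU cU AU]] := noncompact_closure_covers rX lX nB.
exists U; split=> // k.
have [_ [y [sy Ty] <-] yU] := AU k.
have [N NP] := Icell_nbhs (cf _ _ yU).
(* Depth [N] already suffices for the neighbourhood; the extra level makes [u] nonempty. *)
have [u uN uy] := Icell_extend N.+1 sy.
exists u; split; [by case: u uN {uy}|exact: Ty|].
move=> _ [z zu <-]; apply: NP zu => //.
by rewrite size_cat uN ltnW// ltnS leq_addr.
Qed.

Fixpoint branch (g : nat -> nat) (n : nat) : seq nat :=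
  if n is m.+1 then g m :: branch g m else [::].

(** The choices along [g] descend through nested heavy cells whose images avoid the chosen sets.
    Heavy cells are nonempty, so by completeness they share a point [y], and [f y] avoids every
    chosen set. *)
Lemma adaptive_covers (X : topologicalType) (f : Irr -> X) :
  regular_space X -> lindelof X -> continuous f ->
  ~ sigma_covered (range f) ->
  exists W : seq nat -> nat -> set X,
    [/\ forall s k, open (W s k), forall s k, W s k `<=` W s k.+1,
        forall s x, exists k, W s k x
      & forall g, exists x, forall n, ~ W (branch g n) (g n) x].
Proof.
move=> rX lX cf nX.
pose heavy s := ~ sigma_covered (f @` Icell s).
have : forall s : {s | heavy s}, exists p : (nat -> set X) * (nat -> {s | heavy s}),
    [/\ forall k, open (p.1 k), forall k, p.1 k `<=` p.1 k.+1,
        forall x : X, exists k, p.1 k x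
      & forall k, (exists2 u, u != [::] & sval (p.2 k) = u ++ sval s) /\
                  f @` Icell (sval (p.2 k)) `<=` ~` p.1 k].
  move=> [s hs]; have [U [oU mU cU /choice[u uP]]] := heavy_cell_covers rX lX cf hs.
  have hu k : heavy (u k ++ s) by have [] := uP k.
  exists (U, fun k => exist _ _ (hu k)); split=> //= k.
  by have [u0 _ uU] := uP k; split=> //; exists (u k).
move=> /choice[p pP].
have h0 : heavy [::] by [].
(* A node [s] records choices of [k], not the entries of a cell: [t s] is the heavy cell they lead
   to. *)
pose fix t (s : seq nat) : {s | heavy s} :=
  if s is k :: s' then (p (t s')).2 k else exist _ _ h0.
exists (fun s => (p (t s)).1); split=> [s|s|s|g]; try by have [] := pP (t s).
have [||y yP] := @Icell_complete (fun n => sval (t (branch g n))).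
- by move=> n; have [_ _ _ /(_ (g n))[]] := pP (t (branch g n)).
- move=> n; apply: contrapT => h; apply: (svalP (t (branch g n))).
  apply: sigma_covered_compact; rewrite (_ : _ @` _ = set0); first exact: compact0.
  by apply/seteqP; split=> // x [y sy _]; case: h; exists y.
exists (f y) => n; have [_ _ _ /(_ (g n))[_]] := pP (t (branch g n)); apply.
by exists y => //; exact: (yP n.+1).
Qed.

(** * Bar induction and the product with the irrationals *)

Lemma exists_branch (P : seq nat -> Prop) :
  P [::] -> (forall s, P s -> exists k, P (k :: s)) ->
  exists g, forall n, P (branch g n).
Proof.
move=> P0 PS.
have [nx nxP] : exists nx : seq nat -> nat, forall s, P s -> P (nx s :: s).
  have /choice[nx nxP] : forall s, exists k, P s -> P (k :: s).
    move=> s; have [/PS[k Pk]|nPs] := pselect (P s); first by exists k.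
    by exists 0%N.
  by exists nx.
pose fix t n := if n is m.+1 then nx (t m) :: t m else [::].
exists (fun n => nx (t n)) => n.
have -> : branch (fun n => nx (t n)) n = t n by elim: n => //= n ->.
by elim: n => //= n /nxP.
Qed.

Lemma size_branch g n : size (branch g n) = n.
Proof. by elim: n => //= n ->. Qed.

(* The relation [graph] below is an upper semicontinuous compact-valued map from X onto Irr:
   near a given point of X only finitely many of its nodes survive at each depth. Instead
   of proving that, bar induction along the nodes shows that finitely many sets of the
   cover suffice near each (x, m). *)
Lemma lindelof_prod_Irr (X M : topologicalType) (W : seq nat -> nat -> set X) :
  (forall s k, open (W s k)) -> (forall s k, W s k `<=` W s k.+1) ->
  (forall s x, exists k, W s k x) ->
  (forall g, exists x, forall n, ~ W (branch g n) (g n) x) ->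
  lindelof (X * M)%type -> lindelof (M * Irr)%type.
Proof.
move=> oW mW cW gW lXM C Co CT.
have mWle s i j x : (i <= j)%N -> W s i x -> W s j x.
  by move=> /subnK <-; elim: (j - i)%N => // d IH /IH /mW.
(* Here [g] plays two roles: a branch of the tree of covers and a code of [y] in the cell scheme. *)
pose graph x g y :=
  (forall n, ~ W (branch g n) (g n) x) /\ (forall n, Icell (branch g n) y).
pose covered F (B : set (nat -> nat)) (x : X) (m : M) :=
  forall g y, B g -> graph x g y -> (\bigcup_(U in F) U) (m, y).
pose ctrl B (x : X) (m : M) := exists (A : set X) (V : set M) (F : set (set (M * Irr))),
  [/\ nbhs x A, nbhs m V, finite_set F, F `<=` C &
      forall x' m', A x' -> V m' -> covered F B x' m'].
pose cyl s := [set g | branch g (size s) = s].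
have ctrlU B1 B2 x m : ctrl B1 x m -> ctrl B2 x m -> ctrl (B1 `|` B2) x m.
  move=> [A1 [V1 [F1 [xA1 mV1 fF1 CF1 c1]]]] [A2 [V2 [F2 [xA2 mV2 fF2 CF2 c2]]]].
  exists (A1 `&` A2), (V1 `&` V2), (F1 `|` F2); split.
  - exact: filterI.
  - exact: filterI.
  - by rewrite finite_setU.
  - by move=> U [/CF1|/CF2].
  move=> x' m' [A1x A2x] [V1m V2m] g y [B1g|B2g] xgy.
    by have [U FU Uy] := c1 _ _ A1x V1m _ _ B1g xgy; exists U => //; left.
  by have [U FU Uy] := c2 _ _ A2x V2m _ _ B2g xgy; exists U => //; right.
(* On [W s k], monotonicity forces the next entry of [g] below [k], so finitely many successors of
   [s] are enough. *)
have ctrlS s x m : (forall k, ctrl (cyl (k :: s)) x m) -> ctrl (cyl s) x m.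
  move=> sk; have [k xk] := cW s x.
  have : ctrl [set g | cyl s g /\ (g (size s) < k)%N] x m.
    elim: (k) => [|j IH].
      exists setT, setT, set0; split; [exact: filterT|exact: filterT|by []|by []|].
      by move=> x' m' _ _ g y [].
    have := ctrlU _ _ _ _ IH (sk j); congr ctrl; apply/seteqP; split=> g /=.
      case=> [[sg gj]|]; first by split=> //; exact: ltnW.
      by rewrite /cyl /= => -[-> ->].
    by rewrite ltnS leq_eqVlt /cyl /= => -[-> /orP[/eqP ->|]]; [right|left].
  move=> [A [V [F [xA mV fF CF c]]]].
  exists (A `&` W s k), V, F; split=> //.
    by apply: filterI => //; exact: open_nbhs_nbhs.
  move=> x' m' [Ax Wx] Vm g y sg xgy; apply: (c x' m' Ax Vm g y _ xgy); split=> //.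
  rewrite ltnNge; apply/negP => /mWle/(_ Wx).
  by have [/(_ (size s)) + _] := xgy; rewrite sg.
have ctrl0 x m : ctrl (cyl [::]) x m.
  apply: contrapT => n0.
  have [s|g gP] := @exists_branch (fun s => ~ ctrl (cyl s) x m) n0.
    by move=> ns; apply: contrapT => /forallNP nk; apply/ns/ctrlS => k; exact: contrapT (nk k).
  (* If the cells along [g] share a point [y], one member of [C] around [(m, y)] controls a node of
     [g]. Otherwise some cell is empty by completeness, and the empty family controls its node. *)
  have [[y gy]|noy] := pselect (exists y, forall n, Icell (branch g n) y).
    have [U CU Uy] : (\bigcup_(U in C) U) (m, y) by rewrite CT.
    have := Co _ CU; rewrite openE => /(_ _ Uy) [[V N] /= [mV yN] VN].
    have [n nP] := Icell_nbhs yN.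
    apply: (gP n); exists setT, V, [set U]; split=> //; first exact: filterT.
      by move=> _ ->.
    move=> x' m' _ Vm g' y' g'n [_ y'g]; exists U => //; apply: VN; split=> //=.
    apply: nP (gy n) _ _; first by rewrite size_branch.
    by rewrite -g'n size_branch.
  apply: noy; apply: Icell_complete => n; first by exists [:: g n].
  apply: contrapT => ny; apply: (gP n); exists setT, setT, set0; split; [exact: filterT|exact: filterT|by []|by []|].
  move=> x' m' _ _ g' y' g'n [_ y'g]; case: ny; exists y'.
  by rewrite -g'n size_branch.
pose P (G : set (X * M)) := exists F : set (set (M * Irr)),
  [/\ finite_set F, F `<=` C & forall z, G z -> covered F setT z.1 z.2].
have [||Q [/all_and2[_ /choice[F FP]] QT]] := lindelof_sequence (P := P) lXM.
- by exists set0; split.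
- move=> [x m]; have [A [V [F [xA mV fF CF c]]]] := ctrl0 x m.
  exists (A° `*` V°); split=> //.
    rewrite openE => -[x' m'] [/= Ax Vm].
    by exists (A°, V°) => //; split; exact: nbhs_interior.
  exists F; split=> // -[x' m'] [/= /interior_subset Ax /interior_subset Vm] g y _.
  exact: c.
exists (\bigcup_n F n).
  split; first by move=> U [n _]; have [_ + _] := FP n; exact.
  apply: bigcup_countable => // n _; apply: finite_set_countable.
  by have [] := FP n.
apply/seteqP; split=> // -[m y] _.
have [|s|g gy] := @exists_branch (fun s => Icell s y); [by []|exact: Icell_cons|].
(* Surjectivity of the relation: the code [g] of [y] yields a point [x] related to [y], so the
   family chosen near [(x, m)] covers [(m, y)]. *)
have [x xg] := gW g.
have [n Qn] := QT (x, m).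
have [_ _ /(_ _ Qn g y I (conj xg gy))[U FU Uy]] := FP n.
by exists U => //; exists n.
Qed.

(** * Images of Lindelöf spaces and the equivalence *)

Lemma continuous_image_lindelof (X Y : topologicalType) (f : X -> Y) :
  continuous f -> (forall y, exists x, f x = y) -> lindelof X -> lindelof Y.
Proof.
move=> cf sf lX C Co CT.
have [||D [DC cD] DT] := lX [set f @^-1` U | U in C].
- by move=> _ [U CU <-]; apply: open_comp; [move=> x _; exact: cf|exact: Co].
- apply/seteqP; split=> // x _.
  have [U CU Ux] : (\bigcup_(U in C) U) (f x) by rewrite CT.
  by exists (f @^-1` U) => //; exists U.
have imK U : f @` (f @^-1` U) = U.
  by apply/seteqP; split=> [_ [x + <-]|y Uy] //; have [x xy] := sf y; exists x; rewrite /= ?xy.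
exists [set f @` V | V in D].
  split; first by move=> _ [V /DC[U CU <-] <-]; rewrite imK.
  exact: sub_countable (card_image_le _ _) cD.
apply/seteqP; split=> // y _; have [x <-] := sf y.
have [V DV Vx] : (\bigcup_(V in D) V) x by rewrite DT.
by exists (f @` V); [exists V|exists x].
Qed.

Lemma prod_swap_continuous (X Y : topologicalType) :
  continuous (fun z : X * Y => (z.2, z.1)).
Proof. by move=> z; apply: cvg_pair; [exact: cvg_snd|exact: cvg_fst]. Qed.

Lemma lindelof_prodC (X Y : topologicalType) :
  lindelof (X * Y)%type -> lindelof (Y * X)%type.
Proof.
apply: continuous_image_lindelof; first exact: prod_swap_continuous.
by move=> [y x]; exists (x, y).
Qed.

Theorem theorem5p1 :
  (forall X : topologicalType,
      tychonoff_space X -> analytic X -> productively_lindelof X -> sigma_compact_space X)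
  <->
  (exists M : topologicalType, tychonoff_space M /\ michael_space M).
Proof.
split=> [ana|[M [tM [lM nM]]] X [crX _] [f [cf sf]] plX].
  apply: contrapT => noM; apply: Irr_not_sigma_compact.
  apply: (ana _ Irr_tychonoff Irr_analytic) => Y tY lY.
  apply: contrapT => nY; apply: noM; exists Y; split=> //; split=> //.
  by move=> /lindelof_prodC.
have lXM := plX M tM lM.
(* A point of [M] makes the projection of the product onto [X] surjective; an empty [M] would have a
   Lindelöf product. *)
have [m0] : exists m : M, True.
  apply: contrapT => M0; apply: nM => C _ _; exists set0.
    by split=> //; exact: countable0.
  by apply/seteqP; split=> // z _; case: M0; exists z.1.
have lX : lindelof X.
  apply: continuous_image_lindelof lXM; first by move=> z; exact: cvg_fst.
  by move=> x; exists (x, m0).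
have rX := @completely_regular_regular R X crX.
apply: contrapT => nX.
have nf : ~ sigma_covered (range f).
  move=> [K [cK KT]]; apply: nX; exists K; split=> //.
  by apply/seteqP; split=> // x _; apply: KT; have [y <-] := sf x; exists y.
have [W [oW mW cW gW]] := adaptive_covers rX lX cf nf.
exact: nM (lindelof_prod_Irr oW mW cW gW lXM).
Qed.
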